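(* Let $d\ge2$ and let $\mu$ satisfy Conditions 1 and 2 (as defined in the context). Consider the following range condition: (R) there exist $\alpha,\beta>0$ such that for every $C>0$ there exist $C_2,\gamma_2>0$ with $P(R_n\le Cn^{\alpha})\le C_2e^{-\gamma_2 n^{\beta}}$ for all $n\in\mathbb{N}$. (a) If for some $\ell'\in\mathbb{R}^d\setminus\{o\}$ the transverse walk $X'_k=X_k\cdot\ell'$ is, under $P$, a submartingale (with bounded step size) with respect to $\mathcal{F}'_k=\sigma(X'_0,\dots,X'_k)$, and for some $\eta,\eta'>0$ one has $$P\big(|X'_{k+1}-X'_k|>\eta\,\big|\,\mathcal{F}'_k\big)>\eta'\quad\text{for all }k\ge 0,$$ then (R) holds. (b) If $\mu$ is $2$-valued (i.e. supported on exactly two points of $\mathcal{P}$), then (R) holds.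
   Context: Setting (random walk in i.i.d. random environment). Let $o$ be the origin of $\mathbb{Z}^d$ and $\mathcal{E}=\{\pm e_i: i=1,\dots,d\}$ ($e_i$ the standard basis vectors). Let $\mathcal{P}$ be the set of probability measures on $\mathcal{E}$ and $\mu$ a probability measure on $\mathcal{P}$. An environment is $\omega=(\omega_x)_{x\in\mathbb{Z}^d}\in\mathcal{P}^{\mathbb{Z}^d}$, with law $\nu=\mu^{\otimes\mathbb{Z}^d}$. Given $\omega$, $(X_n)_{n\ge 0}$ is the Markov chain on $\mathbb{Z}^d$ started at $X_0=o$ which moves from $x$ to $x+e$ with probability $\omega_x(e)$, $e\in\mathcal{E}$; its (quenched) law is $\mathbb{P}_\omega$, and the annealed/averaged law is $P(\cdot)=\int \mathbb{P}_\omega(\cdot)\,d\nu(\omega)$. The range is $R_n=|\{x: X_m=x\text{ for some }m\le n\}|$. For $\gamma\in\mathcal{P}$ let $\mathcal{S}(\gamma)=\{e\in\mathcal{E}:\gamma(e)>0\}$. A set $V\subset\mathcal{E}$ is orthogonal if $u\cdot v=0$ for every distinct pair $u,v\in V$. Condition 1: there is an orthogonal set $V\subset\mathcal{E}$ with $\mu(\{\gamma:\mathcal{S}(\gamma)\cap V\neq\varnothing\})=1$. Condition 2: there is an orthogonal set $V'\subset\mathcal{E}$ with $|V'|=d$ such that $\mu(\{\gamma: e\in\mathcal{S}(\gamma)\})>0$ for every $e\in V'$. *)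

(* Defs.v *)
(* MathComp + MathComp-Analysis. *)
From HB Require Import structures.
From mathcomp Require Import all_boot all_order all_algebra.
From mathcomp Require Import all_classical all_reals all_analysis.

Set Implicit Arguments.
Unset Strict Implicit.
Unset Printing Implicit Defensive.
Import Order.TTheory GRing.Theory Num.Theory.

Local Open Scope classical_set_scope.
Local Open Scope ring_scope.

(* The dimension is d = n.+1 throughout: a measurableType is pointed, so the
   set of unit steps has to be nonempty. *)

(** ** Sites and unit steps *)

Definition site (n : nat) : Type := 'rV[int]_n.+1.

HB.instance Definition _ n := GRing.Zmodule.on (site n).
HB.instance Definition _ n := isPointed.Build (site n) 0.
HB.instance Definition _ n :=
  @isMeasurable.Build default_measure_display (site n) discrete_measurable
    discrete_measurable0 discrete_measurableC discrete_measurableU.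

(* (i, false) stands for the unit vector e_i and (i, true) for - e_i. *)
Definition step (n : nat) : Type := ('I_n.+1 * bool)%type.

HB.instance Definition _ n := Finite.on (step n).
HB.instance Definition _ n := isPointed.Build (step n) (ord0, false).
HB.instance Definition _ n :=
  @isMeasurable.Build default_measure_display (step n) discrete_measurable
    discrete_measurable0 discrete_measurableC discrete_measurableU.

Definition step_vec n (e : step n) : site n :=
  (-1) ^+ e.2 *: delta_mx 0 e.1 :> 'rV[int]_n.+1.

Definition orthogonal_steps n (V : {set step n}) : Prop :=
  forall u v, u \in V -> v \in V -> u != v ->
    (step_vec u *m (step_vec v)^T) 0 0 = 0.

(** ** Product spaces *)

Definition coordinate_sets (I : Type) d (T : measurableType d) :
    set (set (I -> T)) :=
  \bigcup_(i in [set: I])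
    preimage_set_system setT (fun f : I -> T => f i) measurable.
Arguments coordinate_sets I {d} T _.

Definition product_space (I : Type) d (T : measurableType d) :
    measurableType (coordinate_sets I T).-sigma :=
  g_sigma_algebraType (coordinate_sets I T).

(* The space of probability measures on the unit steps. *)
Definition site_law (n : nat) (R : realType) := pprobability (step n) R.

Definition environment (n : nat) (R : realType) :=
  product_space (site n) (site_law n R).

Definition trajectory (n : nat) := product_space nat (site n).

(** ** Random walk in random environment *)

Section rwre.
Context (n : nat) (R : realType).
Local Open Scope ereal_scope.

(* nu is the product measure mu^{\otimes Z^d}; its values on the measurable
   cylinders determine it. *)
Definition iid_environment (mu : probability (site_law n R) R)
    (nu : probability (environment n R) R) : Prop :=
  forall (s : seq (site n)) (A : site n -> set (site_law n R)),
    uniq s -> (forall x, measurable (A x)) ->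
    nu [set w | forall x, x \in s -> A x (w x)] = \prod_(x <- s) mu (A x).

(* Q w is the law of the Markov chain started at the origin which moves from x
   to x + e with probability w x [set e]. *)
Definition quenched_law (Q : R.-pker (environment n R) ~> (trajectory n)) :
    Prop :=
  forall (w : environment n R) (k : nat) (x : nat -> site n),
    Q w [set X | forall i, (i <= k)%N -> X i = x i] =
    (x 0%N == 0%R)%:R%:E *
    \prod_(i < k) (w (x i)) [set e | step_vec e = (x i.+1 - x i)%R].

Definition annealed (nu : probability (environment n R) R)
    (Q : R.-pker (environment n R) ~> (trajectory n))
    (A : set (trajectory n)) : \bar R :=
  \int[nu]_w Q w A.

Section annealed_probability.
Variables (nu : probability (environment n R) R)
  (Q : R.-pker (environment n R) ~> (trajectory n)).

Let annealed0 : annealed nu Q set0 = 0.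
Proof. by apply: integral0_eq => w _; rewrite measure0. Qed.

Let annealed_ge0 A : 0 <= annealed nu Q A.
Proof. exact: integral_ge0. Qed.

Let annealed_sigma_additive : semi_sigma_additive (annealed nu Q).
Proof.
move=> U mU tU mUU; rewrite [X in _ --> X](_ : _ =
  \int[nu]_w (\sum_(i <oo) Q w (U i))); last first.
  apply: eq_integral => w _.
  by apply/esym/cvg_lim => //; exact/measure_semi_sigma_additive.
apply/cvg_closeP; split.
  by apply: is_cvg_nneseries => k _ _; exact: integral_ge0.
by rewrite closeE// integral_nneseries// => k; exact: measurable_kernel.
Qed.

HB.instance Definition _ := isMeasure.Build _ _ _ (annealed nu Q)
  annealed0 annealed_ge0 annealed_sigma_additive.

Let annealed_setT : annealed nu Q setT = 1.
Proof.
rewrite /annealed (eq_integral (cst 1)).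
  by rewrite integral_cst// mul1e; exact: probability_setT.
by move=> w _; exact: prob_kernel.
Qed.

HB.instance Definition _ :=
  Measure_isProbability.Build _ _ _ (annealed nu Q) annealed_setT.

End annealed_probability.

Definition annealed_law (nu : probability (environment n R) R)
    (Q : R.-pker (environment n R) ~> (trajectory n)) :
    probability (trajectory n) R :=
  annealed nu Q.

(** ** Assumptions on the law of the environment at a site *)

Definition step_support (g : site_law n R) : set (step n) :=
  [set e | 0 < g [set e]].

Definition condition1 (mu : probability (site_law n R) R) : Prop :=
  exists2 V : {set step n}, orthogonal_steps V &
    mu [set g | step_support g `&` [set` V] !=set0] = 1.

Definition condition2 (mu : probability (site_law n R) R) : Prop :=
  exists V' : {set step n}, [/\ orthogonal_steps V', #|V'| = n.+1 &
    forall e, e \in V' -> 0 < mu [set g | step_support g e]].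

Definition two_valued (mu : probability (site_law n R) R) : Prop :=
  exists g1 g2 : site_law n R,
    [/\ g1 <> g2, 0 < mu [set g1], 0 < mu [set g2] &
        mu [set g1; g2] = 1].

(** ** The range *)

(* R_k, the number of sites visited up to time k. *)
Definition range_size (k : nat) (X : trajectory n) : nat :=
  size (undup [seq X m | m <- iota 0 k.+1]).

Definition range_condition (P : probability (trajectory n) R) : Prop :=
  exists alpha beta : R, [/\ (0 < alpha)%R, (0 < beta)%R &
    forall C : R, (0 < C)%R ->
    exists C2 gamma2 : R, [/\ (0 < C2)%R, (0 < gamma2)%R &
      forall k : nat,
        P [set X | ((range_size k X)%:R <= C * k%:R `^ alpha)%R] <=
        (C2 * expR (- gamma2 * k%:R `^ beta))%:E]].

(* The transverse walk X_k . l. *)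
Definition transverse (l : 'rV[R]_n.+1) (k : nat) (X : trajectory n) : R :=
  (map_mx intr (X k) *m l^T)%R 0%R 0%R.

End rwre.

(** ** Conditional expectation and submartingales *)

Section conditioning.
Context d (T : measurableType d) (R : realType) (P : probability T R).
Local Open Scope ereal_scope.

(* g is a version of the conditional expectation E[Y | G]. *)
Definition is_cond_exp (G : set (set T)) (Y g : T -> R) : Prop :=
  [/\ forall B, measurable B -> G (g @^-1` B),
      P.-integrable setT (EFin \o g) &
      forall A, G A -> \int[P]_(t in A) (g t)%:E = \int[P]_(t in A) (Y t)%:E].

(* sigma(Z_0, ..., Z_k) *)
Definition natural_filtration (Z : nat -> T -> R) (k : nat) : set (set T) :=
  <<s \bigcup_(i in [set i | (i <= k)%N])
        preimage_set_system setT (Z i) measurable >>.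

Definition submartingale (F : nat -> set (set T)) (Z : nat -> T -> R) : Prop :=
  [/\ forall k B, measurable B -> F k (Z k @^-1` B),
      forall k, P.-integrable setT (EFin \o Z k) &
      forall k, exists2 g, is_cond_exp (F k) (Z k.+1) g &
        {ae P, forall t, (Z k t <= g t)%R}].

Definition bounded_steps (Z : nat -> T -> R) : Prop :=
  exists B : R, forall k, {ae P, forall t, (`|Z k.+1 t - Z k t| <= B)%R}.

(* P(|Z_{k+1} - Z_k| > eta | F_k) > eta' almost surely, for all k. *)
Definition nondegenerate_steps (F : nat -> set (set T)) (Z : nat -> T -> R)
    (eta eta' : R) : Prop :=
  forall k, exists2 g,
    is_cond_exp (F k) \1_[set t | (eta < `|Z k.+1 t - Z k t|)%R] g &
    {ae P, forall t, (eta' < g t)%R}.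

End conditioning.

(* Main.v *)
Require Import Defs.
From HB Require Import structures.
From mathcomp Require Import all_boot all_order all_algebra.
From mathcomp Require Import all_classical all_reals all_analysis.
From mathcomp Require Import measurable_realfun ring lra.

Set Implicit Arguments.
Unset Strict Implicit.
Unset Printing Implicit Defensive.
Import Order.TTheory GRing.Theory Num.Theory.

Local Open Scope classical_set_scope.
Local Open Scope ring_scope.

(** Both parts follow from one estimate: for some [c > 0], every [r >= 0] and
    every [k], [P (R_k <= r) <= 2 exp (- c k / (r + 1) ^ 2)]. With
    [r = C k ^ (1/4)] the exponent is of order [k ^ (1/2)], which is condition
    (R) with [alpha = 1/4] and [beta = 1/2]
    ([range_condition_of_confinement]). A nearest-neighbour path from the origin
    that visits at most [r] sites never gets further than [r] from the origin
    ([range_size_ge]), so what has to be bounded is the probability that the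
    walk stays for [k] steps in a box of size of order [r].

    Confinement is ruled out by a Lyapunov function ([confinement]). Let [phi]
    take values in [[0, Phi]] on the box and its neighbours, and let its expected
    one-step increment be at least [c] at every point of the box. Then
    [f = 2 - phi / Phi] lies between 1 and 2 on the box, and one step multiplies
    its expectation by at most [exp (- c / (2 Phi))]; hence the walk stays in the
    box for [k] steps with probability at most [2 exp (- c k / (2 Phi))]. It
    remains to find [phi] with [Phi] of order [(r + 1) ^ 2] and [c] independent
    of [r].

    In part (a), [phi v = (v + L) ^ 2], where [L], proportional to [r], bounds
    the transverse walk. As [v + L >= 0] when [|v| <= L], the submartingale
    property makes the linear term of the increment nonnegative, and the
    nondegeneracy makes the quadratic term at least [eta ^ 2 eta']. The
    conditional expectations are only evaluated on the atoms
    [{X'_0 = v_0, ..., X'_k = v_k}], where they become finite sums because the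
    transverse walk has finitely many possible jumps.

    Part (b) is proved for the quenched law in every environment all of whose
    site laws are one of the two atoms [g1], [g2] of [mu]; almost every
    environment is of this form. A function of quadratic growth on [R ^ d] with
    uniformly positive drift under both [g1] and [g2] is needed. Let [m1] and
    [m2] be the mean steps.
    - If [m1 = 0], then [|v| ^ 2] plus a large multiple of [v . m2] will do
      ([common_drift_centered]).
    - If some [l] has positive product with both means, the linear function
      [v . l] will do ([common_drift_linear]).
    - Otherwise [m1] and [m2] are opposite. With [u = m2], the quadratic form
      [|u| ^ 2 |v| ^ 2 - (v . u) ^ 2] does not see the motion along [u] and gains
      on average the transverse variance of the step. By Condition 2 and
      [d >= 2] this variance is positive for one of the two laws, and a linear
      function pointing along the mean of the other law supplies the drift there
      ([common_drift_opposite]). *)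

(** * Finite histories of a process and escape from a box *)

Section history.
Context d (T : measurableType d) (R : realType).
(* A measure of total mass one, so as to cover both the annealed law and the
   values of the quenched kernel. *)
Context (P : {measure set T -> \bar R}) (P1 : P setT = 1%E).

Definition prob (A : set T) : R := fine (P A).

Lemma fin_num_unit_mass A : measurable A -> P A \is a fin_num.
Proof.
move=> mA; rewrite ge0_fin_numE//; apply: (@le_lt_trans _ _ (P setT)).
  by apply: le_measure; rewrite ?inE//; exact: measurableT.
by rewrite P1 ltry.
Qed.

Lemma probE A : measurable A -> P A = (prob A)%:E.
Proof. by move=> mA; rewrite /prob fineK// fin_num_unit_mass. Qed.

Lemma prob_ge0 A : 0 <= prob A.
Proof. by rewrite /prob fine_ge0. Qed.

Lemma le_prob A B : measurable A -> measurable B -> A `<=` B ->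
  prob A <= prob B.
Proof.
by move=> mA mB AB; rewrite -lee_fin -!probE//; apply: le_measure; rewrite ?inE.
Qed.

Lemma probU A B : measurable A -> measurable B -> A `&` B = set0 ->
  prob (A `|` B) = prob A + prob B.
Proof.
move=> mA mB AB; apply: EFin_inj; rewrite EFinD -!probE//.
  by rewrite measureU.
exact: measurableU.
Qed.

Lemma measureC_full A : measurable A -> P A = 1%E -> P (~` A) = 0%E.
Proof.
move=> mA PA; have /eqP : P (A `|` ~` A) = (P A + P (~` A))%E.
  by rewrite measureU ?setICr//; exact: measurableC.
rewrite setUv P1 PA probE; last exact: measurableC.
rewrite -EFinD => /eqP[] /eqP.
by rewrite -subr_eq0 opprD addrA subrr add0r oppr_eq0 => /eqP ->.
Qed.

(** Inclusions between events only have to be checked on an almost sure event. *)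
Lemma le_measure_full A B C : measurable A -> measurable B -> measurable C ->
  P A = 1%E -> A `&` B `<=` C -> (P B <= P C)%E.
Proof.
move=> mA mB mC PA ABC; have mA' := measurableC mA.
rewrite -[leRHS](measureU0 mC mA' (measureC_full mA PA)).
apply: le_measure; rewrite ?inE//; first exact: measurableU.
by move=> t Bt; have [At|At] := pselect (A t); [left; apply: ABC|right].
Qed.

Context (S : eqType).

Lemma preimage_mem_seq (Z : T -> S) (ts : seq S) :
  (forall s, measurable (Z @^-1` [set s])) ->
  measurable [set t | Z t \in ts].
Proof.
move=> mZ; elim: ts => [|s ts IH].
  by rewrite [X in measurable X](_ : _ = set0)//; apply/seteqP; split.
rewrite [X in measurable X](_ : _ =
  Z @^-1` [set s] `|` [set t | Z t \in ts]); first exact: measurableU.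
apply/seteqP; split=> t /=; rewrite inE; first by case/predU1P; [left|right].
by case=> [->|->]; rewrite ?eqxx ?orbT.
Qed.

Lemma prob_fibers (Z : T -> S) (ts : seq S) (A : set T) :
  (forall s, measurable (Z @^-1` [set s])) -> measurable A -> uniq ts ->
  prob (A `&` [set t | Z t \in ts]) =
  \sum_(s <- ts) prob (A `&` Z @^-1` [set s]).
Proof.
move=> mZ mA; elim: ts => [_|s ts IH /andP[sts uts]].
  rewrite big_nil [X in prob X](_ : _ = set0) ?/prob ?measure0//.
  by apply/seteqP; split=> // t [].
rewrite big_cons -IH// -probU; last 1 first.
- apply/seteqP; split=> // t /= [[_ Zs] [_]].
  by rewrite Zs (negPf sts).
- congr prob; rewrite -setIUr; congr (_ `&` _).
  apply/seteqP; split=> t /=; rewrite inE; first by case/predU1P; [left|right].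
  by case=> [->|->]; rewrite ?eqxx ?orbT.
- exact: measurableI.
- by apply: measurableI => //; exact: preimage_mem_seq.
Qed.

Variable Y : nat -> T -> S.
Hypothesis mY : forall i s, measurable (Y i @^-1` [set s]).

Definition history (k : nat) (h : nat -> S) : set T :=
  [set t | forall i, (i <= k)%N -> Y i t = h i].

Definition extend (k : nat) (h : nat -> S) (s : S) : nat -> S :=
  fun i => if (i <= k)%N then h i else s.

Lemma extend_last k h s : extend k h s k.+1 = s.
Proof. by rewrite /extend ltnn. Qed.

Lemma history_extend k h s :
  history k.+1 (extend k h s) = history k h `&` Y k.+1 @^-1` [set s].
Proof.
apply/seteqP; split=> t.
  move=> H; split; last by rewrite /= H// extend_last.
  by move=> i ik; rewrite H ?(leqW ik)// /extend ik.
move=> [H Ys] i; rewrite leq_eqVlt ltnS => /predU1P[->|ik].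
  by rewrite extend_last.
by rewrite H// /extend ik.
Qed.

Lemma measurable_history k h : measurable (history k h).
Proof.
rewrite [X in measurable X](_ : _ =
  \bigcap_(i in [set i | (i <= k)%N]) (Y i @^-1` [set h i])); last by apply/seteqP; split.
by apply: bigcap_measurableType => i _; exact: mY.
Qed.

Variables (box : pred S) (next : S -> seq S).

Definition stay (k j : nat) : set T :=
  [set t | forall i, (k <= i <= k + j)%N -> Y i t \in box].

Hypothesis mbox : forall i, measurable (Y i @^-1` [set` box]).
Hypothesis next_uniq : forall s, uniq (next s).
Hypothesis next_as : forall k h, h k \in box ->
  P (history k h `&` [set t | Y k.+1 t \notin next (h k)]) = 0%E.

Lemma measurable_stay k j : measurable (stay k j).
Proof.
rewrite [X in measurable X](_ : _ = \bigcap_(i in [set i | (k <= i <= k + j)%N])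
  (Y i @^-1` [set` box])); last by apply/seteqP; split.
by apply: bigcap_measurableType => i _; exact: mbox.
Qed.

(** The process moves to one of the finitely many points of [next (h k)] almost
    surely, so conditioning on the next value is a finite sum. *)
Lemma prob_history_next k h A : h k \in box -> measurable A ->
  prob (history k h `&` A) =
  \sum_(s <- next (h k)) prob (history k.+1 (extend k h s) `&` A).
Proof.
move=> hk mA; have mB := preimage_mem_seq (next (h k)) (mY k.+1).
have mh := measurable_history k h.
under eq_bigr do rewrite history_extend setIAC.
rewrite -prob_fibers//; last exact: measurableI.
apply: EFin_inj; rewrite -!probE; [|by repeat apply: measurableI..].
rewrite -[in RHS](@measureU0 _ _ _ P _
  (history k h `&` A `&` ~` [set t | Y k.+1 t \in next (h k)])).
- by rewrite -setIUr setUv setIT.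
- by repeat apply: measurableI.
- by apply: measurableI; [exact: measurableI|exact: measurableC].
- apply/eqP; rewrite -measure_le0.
  rewrite -[leRHS](next_as hk); apply: le_measure; rewrite ?inE.
  + by apply: measurableI; [exact: measurableI|exact: measurableC].
  + rewrite [X in _ `&` X](_ : _ = ~` [set t | Y k.+1 t \in next (h k)]).
      by apply: measurableI => //; exact: measurableC.
    by apply/seteqP; split=> t /= /negP.
  + by move=> t [[? _] /= /negP].
Qed.

Variables (phi : S -> R) (c Phi : R).
Hypothesis Phi_gt0 : 0 < Phi.
Hypothesis phi_box : forall s, s \in box -> 0 <= phi s <= Phi.
Hypothesis phi_next : forall s r, s \in box -> r \in next s -> 0 <= phi r <= Phi.
Hypothesis drift : forall k h, h k \in box ->
  prob (history k h) * (phi (h k) + c) <=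
  \sum_(s <- next (h k)) prob (history k.+1 (extend k h s)) * phi s.

(* Normalized so that staying in the box keeps [f] between 1 and 2; [rho] is the
   contraction factor of the mean of [f] in one step. *)
Let f s := 2 - phi s / Phi.
Let rho := expR (- (c / (2 * Phi))).

Hypothesis c_ge0 : 0 <= c.

(** Induction on the number of steps, from the end: a first step to a point
    outside the box contributes nothing on the left and a nonnegative term on the
    right, since [f] is still nonnegative at the neighbours of the box. *)
Lemma confinement_history j k h : h k \in box ->
  prob (history k h `&` stay k j) <= prob (history k h) * rho ^+ j * f (h k).
Proof.
elim: j k h => [|j IH] k h hk.
  rewrite expr0 mulr1; apply: (@le_trans _ _ (prob (history k h))).
    apply: le_prob; [|exact: measurable_history|by move=> ? []].
    by apply: measurableI; [exact: measurable_history|exact: measurable_stay].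
  rewrite ler_peMr ?prob_ge0// /f; have /andP[_ H] := phi_box hk.
  by rewrite lerBrDr addrC -lerBrDr ler_pdivrMr// (natrD _ 1 1) addrK mul1r.
have mh := measurable_history; have ms := measurable_stay.
rewrite prob_history_next//.
apply: (@le_trans _ _ (\sum_(s <- next (h k))
    prob (history k.+1 (extend k h s)) * rho ^+ j * f s)).
  rewrite big_seq [leRHS]big_seq; apply: ler_sum => s sn.
  have /andP[_ phis] := phi_next hk sn.
  have [sb|sb] := boolP (s \in box).
    rewrite -[X in f X](extend_last k h); apply: le_trans (IH k.+1 _ _).
      apply: le_prob; [exact: measurableI..|].
      move=> t [H G]; split=> // i /andP[ki ij]; apply: G.
      by rewrite (ltnW ki) addnS -addSn.
    by rewrite extend_last.
  rewrite [X in prob X](_ : _ = set0); first rewrite /prob measure0.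
    rewrite !mulr_ge0 ?prob_ge0 ?exprn_ge0 ?expR_ge0// /f subr_ge0.
    by rewrite ler_pdivrMr// (le_trans phis)// ler_peMl ?ler1n// ltW.
  apply/seteqP; split=> // t [H G]; move: sb => /negP; apply.
  rewrite -(extend_last k h s) -H//; apply: G.
  by rewrite leqnSn addnS ltnS leq_addr.
have -> : \sum_(s <- next (h k)) prob (history k.+1 (extend k h s)) * rho ^+ j * f s =
  rho ^+ j * (2 * prob (history k h) - (\sum_(s <- next (h k))
     prob (history k.+1 (extend k h s)) * phi s) / Phi).
  rewrite -[X in prob X](setIT (history k h)) prob_history_next//.
  under [in RHS]eq_bigr do rewrite setIT.
  rewrite mulr_suml mulr_sumr -sumrB mulr_sumr; apply: eq_bigr => s _.
  by rewrite /f; ring.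
apply: (@le_trans _ _ (rho ^+ j * (prob (history k h) * (f (h k) - c / Phi)))).
  rewrite ler_wpM2l ?exprn_ge0 ?expR_ge0//.
  have -> : prob (history k h) * (f (h k) - c / Phi) = 2 * prob (history k h)
     - (prob (history k h) * (phi (h k) + c)) / Phi by rewrite /f; ring.
  by rewrite lerB// ler_pM2r ?invr_gt0// drift.
rewrite -[leRHS]mulrA [leRHS]mulrCA exprSr -mulrA.
rewrite ler_wpM2l ?exprn_ge0 ?expR_ge0//.
rewrite [leRHS]mulrCA ler_wpM2l ?prob_ge0//.
have /andP[p0 _] := phi_box hk.
have f1 : f (h k) <= 2 by rewrite /f lerBlDr lerDl divr_ge0// ltW.
have f0 : 0 <= f (h k).
  rewrite /f subr_ge0 ler_pdivrMr//; have /andP[_ /le_trans] := phi_box hk.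
  by apply; rewrite ler_peMl ?ler1n// ltW.
apply: (@le_trans _ _ ((1 - c / (2 * Phi)) * f (h k))).
  rewrite mulrBl mul1r lerB//.
  have -> : c / Phi = c / (2 * Phi) * 2 by field; exact: lt0r_neq0.
  by rewrite ler_wpM2l// divr_ge0// mulr_ge0// ltW.
by rewrite ler_wpM2r// expR_ge1Dx.
Qed.

(** A function with values in [[0, Phi]] and drift at least [c] grows on average by
    [c] per step, so the process is unlikely to stay in the box much
    longer than [Phi / c] steps. *)
Theorem confinement s0 k : s0 \in box -> P (Y 0 @^-1` [set s0]) = 1%E ->
  (P (stay 0 k) <= (2 * expR (- (c * k%:R / (2 * Phi))))%:E)%E.
Proof.
move=> s0b Ps0; have /= := @confinement_history k 0 (fun=> s0) s0b.
have -> : history 0 (fun=> s0) = Y 0 @^-1` [set s0].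
  by apply/seteqP; split=> t /=; [exact|move=> H i; rewrite leqn0 => /eqP ->].
rewrite [X in X * _ * _]/prob Ps0 mul1r => H.
have mA := mY 0 s0; have mS := measurable_stay 0 k.
apply: (@le_trans _ _ (P (Y 0 @^-1` [set s0] `&` stay 0 k))).
  by apply: (le_measure_full mA) => //; exact: measurableI.
rewrite probE ?lee_fin; last exact: measurableI.
apply: (le_trans H); rewrite mulrC ler_pM ?exprn_ge0//.
- rewrite subr_ge0 ler_pdivrMr//; have /andP[_ /le_trans] := phi_box s0b.
  by apply; rewrite ler_peMl ?ler1n// ltW.
- exact: expR_ge0.
- have /andP[p0 _] := phi_box s0b.
  by rewrite gerBl divr_ge0// ltW.
- by rewrite -(expRM_natr k (- (c / (2 * Phi)))) mulNr mulrAC.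
Qed.
End history.

(** * Nearest-neighbour trajectories and their range *)

Section trajectories.
Context (n : nat).

Lemma measurable_position i (B : set (site n)) :
  measurable [set X : trajectory n | B (X i)].
Proof.
apply: sub_sigma_algebra; exists i => //; exists B => //.
by rewrite setTI.
Qed.

(** Sites are countable, so an event that depends on finitely many positions is a
    countable union of cylinders. *)
Lemma measurable_past k (A : set (trajectory n)) :
  (forall X X' : trajectory n, (forall i, (i <= k)%N -> X i = X' i) -> A X -> A X') ->
  measurable A.
Proof.
move=> Ak.
rewrite [X in measurable X](_ : _ = \bigcup_(s : seq 'rV[int]_n.+1)
  [set X | A X /\ mkseq X k.+1 = s]); last first.
  apply/seteqP; split=> [X AX|X [s _] []//].
  by exists (mkseq X k.+1).
apply: countable_bigcupT_measurable => [|s]; first exact: countableP.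
have [[X0 [AX0 X0s]]|noX] := pselect (exists X : trajectory n, A X /\ mkseq X k.+1 = s).
  rewrite [X in measurable X](_ : _ =
      history (fun i (X : trajectory n) => X i) k (nth 0 s)).
    by apply: measurable_history => i x; exact: measurable_position.
  apply/seteqP; split=> [X [_ <-] i ik|X Xs].
    by rewrite nth_mkseq.
  have XX0 i : (i <= k)%N -> X0 i = X i by move=> ik; rewrite Xs// -X0s nth_mkseq.
  split; first exact: Ak AX0.
  by rewrite -X0s; apply/eq_in_map => i; rewrite mem_iota => /andP[_]; move/XX0.
rewrite [X in measurable X](_ : _ = set0)//; apply/seteqP; split=> // X HX.
by case: noX; exists X.
Qed.

Definition neighbours (x : site n) : seq (site n) :=
  [seq x + step_vec e | e <- enum {: step n}].

Lemma step_vec_inj : injective (@step_vec n).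
Proof.
move=> [i b] [j b'] /matrixP eqv; have := eqv 0 i; rewrite !mxE !eqxx/=.
have [->|ij] := eqVneq i j; last by rewrite mulr0 => /eqP; rewrite mulr1 signr_eq0.
by rewrite !mulr1 => /signr_inj ->.
Qed.

Lemma neighbours_uniq x : uniq (neighbours x).
Proof. by rewrite map_inj_uniq ?enum_uniq// => e e' /addrI /step_vec_inj. Qed.

Lemma neighboursP x y : reflect (exists e, y = x + step_vec e) (y \in neighbours x).
Proof.
by apply: (iffP mapP) => [[e _]|[e]] ->; exists e; rewrite ?mem_enum.
Qed.

Definition walk_from (k j : nat) : set (trajectory n) :=
  [set X | forall i, (k <= i < k + j)%N -> X i.+1 \in neighbours (X i)].

Lemma measurable_walk_from k j : measurable (walk_from k j).
Proof.
apply: (@measurable_past (k + j)) => X X' XX' + i /andP[ki ikj].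
by rewrite -!XX' ?(ltnW ikj)//; apply; rewrite ki.
Qed.

(** A function that grows by at most one at each step can only reach a new
    maximum at a site visited for the first time, so the range grows at least as
    fast as its running maximum. *)
Lemma range_size_ge (R : realType) (N : site n -> R) k (X : trajectory n) :
    N 0 <= 0 -> (forall x e, N (x + step_vec e) <= N x + 1) ->
    X 0%N = 0 -> walk_from 0 k X ->
  forall i, (i <= k)%N -> N (X i) + 1 <= (range_size k X)%:R.
Proof.
move=> N0 NS X0 Xk; rewrite /walk_from/= in Xk.
suff H j i : (i <= j <= k)%N -> N (X i) + 1 <= (range_size j X)%:R.
  by move=> i ik; apply: H; rewrite ik/=.
elim: j i => [|j IH] i /andP[]; first by rewrite leqn0 => /eqP -> _; rewrite X0 gerDr.
move=> ij jk.
have -> : range_size j.+1 X =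
    ((X j.+1 \notin [seq X m | m <- iota 0 j.+1]) + range_size j X)%N.
  rewrite /range_size -[in LHS]addn1 iotaD map_cat [map _ (iota _ 1)]/= add0n.
  move: [seq X m | m <- iota 0 j.+1] => s.
  rewrite (@perm_size _ _ (undup (X j.+1 :: s))); last first.
    apply: uniq_perm; rewrite ?undup_uniq// => x.
    by rewrite !mem_undup mem_cat mem_seq1 inE orbC.
  by rewrite [undup _]/=; case: ifP.
have [new|old] := boolP (X j.+1 \in _).
  rewrite add0n; move: ij; rewrite leq_eqVlt => /predU1P[->|].
    move/mapP: new => [m]; rewrite mem_iota => /andP[_ mj] ->.
    by apply: IH; rewrite -ltnS mj ltnW.
  by rewrite ltnS => ij; apply: IH; rewrite ij ltnW.
rewrite natrD addrC lerD2l; move: ij; rewrite leq_eqVlt => /predU1P[->|].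
  have /neighboursP[e ->] : X j.+1 \in neighbours (X j) by exact: Xk.
  by apply: le_trans (NS _ _) _; apply: IH; rewrite leqnn ltnW.
rewrite ltnS => ij; apply: (@le_trans _ _ (N (X i) + 1)); first by rewrite lerDl.
by apply: IH; rewrite ij ltnW.
Qed.

Lemma measurable_range_le (R : realType) k (r : R) :
  measurable [set X : trajectory n | (range_size k X)%:R <= r].
Proof.
apply: (@measurable_past k) => X X' XX' /=; rewrite /range_size.
suff -> : [seq X m | m <- iota 0 k.+1] = [seq X' m | m <- iota 0 k.+1] by [].
by apply/eq_in_map => i; rewrite mem_iota => /andP[_]; exact: XX'.
Qed.

(** With [r = C k ^ (1/4)] one has [(r + 1) ^ 2 <= (C + 1) ^ 2 k ^ (1/2)] for
    [k >= 1], and for [k = 0] both exponents vanish. *)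
Lemma range_condition_of_confinement (R : realType) (P : probability (trajectory n) R)
    (c : R) : 0 < c ->
  (forall (r : R) k, 0 <= r -> (P [set X | ((range_size k X)%:R <= r)%R] <=
     (2 * expR (- (c * k%:R / (r + 1) ^+ 2)))%:E)%E) ->
  range_condition P.
Proof.
move=> c0 H; exists (4^-1), (2^-1); split; rewrite ?invr_gt0// => C C0.
exists 2, (c / (C + 1) ^+ 2); split => //.
  by rewrite divr_gt0// exprn_gt0// addr_gt0.
move=> k; apply: (le_trans (H _ _ _)); first by rewrite mulr_ge0 ?powR_ge0// ltW.
rewrite lee_fin ler_pM2l// ler_expR mulNr lerN2.
set q := k%:R `^ 4^-1.
have q0 : 0 <= q by exact: powR_ge0.
have sq : k%:R `^ 2^-1 = q ^+ 2.
  rewrite /q -powR_mulrn ?powR_ge0// -powRrM; congr (_ `^ _).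
  by field.
have q4 : k%:R = q ^+ 4.
  rewrite /q -powR_mulrn ?powR_ge0// -powRrM mulVf ?powRr1//.
rewrite sq q4.
have C1 : 0 < C + 1 by rewrite addr_gt0.
have Cq : 0 < C * q + 1 by rewrite ltr_wpDl// mulr_ge0// ltW.
rewrite [leLHS]mulrAC ler_pdivrMr ?exprn_gt0// [leRHS]mulrAC.
rewrite ler_pdivlMr ?exprn_gt0//.
have [k0|kpos] := posnP k.
  have -> : q = 0 by rewrite /q k0 powR0// invr_eq0.
  by rewrite !expr0n/= !mulr0 !mul0r.
have q1 : 1 <= q by rewrite -(powRr0 k%:R) /q ler_powR ?ler1n ?invr_ge0.
rewrite -(mulrA c) -(mulrA c) ler_pM2l// (_ : q ^+ 4 = q ^+ 2 * q ^+ 2).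
  2: by rewrite -exprD.
rewrite -mulrA ler_wpM2l ?sqr_ge0// -exprMn lerXn2r ?nnegrE ?mulr_ge0 ?(ltW C1) ?(ltW Cq)//.
by rewrite mulrDr mulr1 mulrC lerD2l.
Qed.
End trajectories.

(** * The quenched walk *)

Section quenched.
Context (n : nat) (R : realType) (Q : R.-pker (environment n R) ~> (trajectory n)).
Hypothesis Q_markov : quenched_law Q.

Let position (i : nat) (X : trajectory n) : site n := X i.
Let m_position i x : measurable (position i @^-1` [set x]).
Proof. exact: measurable_position. Qed.

Definition weight (g : site_law n R) (e : step n) : R := fine (g [set e]).

Lemma weight_ge0 g e : 0 <= weight g e.
Proof. by rewrite fine_ge0. Qed.

Lemma sum_weight g : \sum_e weight g e = 1.
Proof.
have g1 := @probability_setT _ _ _ g.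
have := @prob_fibers _ _ _ _ g1 _ id (enum {: step n}) setT.
rewrite [X in prob _ X](_ : _ = setT); last first.
  by apply/seteqP; split=> // e _; split=> //=; rewrite mem_enum.
rewrite [prob _ setT](congr1 fine g1) big_enum => H.
rewrite -[RHS]/(fine 1%E) H //; last exact: enum_uniq.
by apply: eq_bigr => e _; rewrite setTI.
Qed.

Lemma quenched_extend w k h e :
  Q w (history position k.+1 (extend k h (h k + step_vec e))) =
  (Q w (history position k h) * (weight (w (h k)) e)%:E)%E.
Proof.
rewrite /history !Q_markov big_ord_recr/= muleA; congr (_ * _ * _)%E.
  by apply: eq_bigr => i _; rewrite /extend ltn_ord (ltnW (ltn_ord i)).
rewrite extend_last /extend leqnn /weight fineK ?fin_num_measure//.
congr (_ _); apply/seteqP; split=> e' /=; last by move=> ->; rewrite addrC addKr.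
by rewrite addrC addKr => /step_vec_inj.
Qed.

Lemma quenched_next w k h (F : site n -> R) :
  \sum_(x <- neighbours (h k)) prob (Q w) (history position k.+1 (extend k h x)) * F x =
  prob (Q w) (history position k h) *
    \sum_e weight (w (h k)) e * F (h k + step_vec e).
Proof.
rewrite big_map big_enum mulr_sumr; apply: eq_bigr => e _.
rewrite /prob quenched_extend fineM ?mulrA//.
by rewrite fin_num_unit_mass ?prob_kernel//; exact: measurable_history.
Qed.

(** The cylinder probabilities of the one-step continuations of a history add up
    to that of the history, so no mass is left for other trajectories. *)
Lemma quenched_walk_history w j k h :
  prob (Q w) (history position k h) <=
  prob (Q w) (history position k h `&` walk_from k j).
Proof.
have Q1 := @prob_kernel _ _ _ _ _ Q w.
elim: j k h => [|j IH] k h.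
  rewrite [X in _ <= prob _ X](_ : _ = history position k h)//.
  apply/seteqP; split=> [t []//|t ht]; split=> // i.
  by rewrite addn0 => /andP[/leq_ltn_trans H /H]; rewrite ltnn.
have mh := measurable_history m_position; have mw := @measurable_walk_from n.
have -> : prob (Q w) (history position k h) = \sum_(x <- neighbours (h k))
    prob (Q w) (history position k.+1 (extend k h x)).
  under [RHS]eq_bigr do rewrite -[prob _ _]mulr1.
  rewrite (quenched_next _ _ _ (fun=> 1)).
  by under eq_bigr do rewrite mulr1; rewrite sum_weight mulr1.
apply: le_trans (ler_sum _ (fun x _ => IH k.+1 (extend k h x))) _.
under eq_bigr do rewrite history_extend setIAC.
rewrite -(prob_fibers Q1)//; last 2 first.
- exact: measurableI.
- exact: neighbours_uniq.
apply: (le_prob Q1).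
- apply: measurableI; first exact: measurableI.
  exact: (preimage_mem_seq _ (m_position k.+1)).
- exact: measurableI.
- move=> X [[hX wX] /= Xk]; split=> // i /andP[]; rewrite leq_eqVlt.
  move=> /predU1P[<- _|ki ij]; first by rewrite [X k]hX.
  by apply: wX; rewrite ki addSn -addnS.
Qed.

Definition walks (j : nat) : set (trajectory n) :=
  [set X | X 0%N = 0] `&` walk_from 0 j.

Lemma measurable_walks j : measurable (walks j).
Proof.
by apply: measurableI; [exact: (measurable_position 0 [set 0])|exact: measurable_walk_from].
Qed.

Lemma quenched_walks w j : Q w (walks j) = 1%E.
Proof.
have Q1 := @prob_kernel _ _ _ _ _ Q w.
have h0 : history position 0 (fun=> 0) = [set X | X 0%N = 0].
  by apply/seteqP; split=> X /=; [exact|move=> H i; rewrite leqn0 => /eqP ->].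
have Qh0 : Q w (history position 0 (fun=> 0)) = 1%E.
  by rewrite /history Q_markov big_ord0 mule1 eqxx.
apply/eqP; rewrite eq_le; apply/andP; split.
  by rewrite -Q1; apply: le_measure; rewrite ?inE//; exact: measurable_walks.
have := quenched_walk_history w j 0 (fun=> 0); rewrite {1}/prob Qh0 h0 -/(walks j).
by rewrite (probE Q1 (measurable_walks j)) lee_fin.
Qed.

Lemma annealed_walks (nu : probability (environment n R) R) j :
  annealed_law nu Q (walks j) = 1%E.
Proof.
rewrite /annealed_law/= /annealed (eq_integral (cst 1%E)).
  by rewrite integral_cst// mul1e; exact: probability_setT.
by move=> w _; rewrite quenched_walks.
Qed.

End quenched.

(** * Submartingales with finitely many jumps *)

Lemma ae_le_integral d (T : measurableType d) (R : realType)
    (mu : {measure set T -> \bar R}) (A : set T) (f g : T -> \bar R) :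
  measurable A -> mu.-integrable A f -> mu.-integrable A g ->
  {ae mu, forall t, (f t <= g t)%E} ->
  (\int[mu]_(t in A) f t <= \int[mu]_(t in A) g t)%E.
Proof.
move=> mA fint gint [N [mN N0 fgN]].
rewrite (negligible_integral mN mA fint N0) (negligible_integral mN mA gint N0).
apply: le_integral; first exact: measurableD.
- by apply: integrableS fint => //; exact: measurableD.
- by apply: integrableS gint => //; exact: measurableD.
- by move=> t; rewrite inE => -[_ Nt]; move/subsetCl : fgN => /(_ _ Nt).
Qed.

Section submartingales.
Context d (T : measurableType d) (R : realType) (P : probability T R).
Variable Z : nat -> T -> R.
Let F := natural_filtration Z.

Lemma natural_filtration_history k h : F k (history Z k h).
Proof.
rewrite [X in F k X](_ : _ =
  \bigcap_(i in [set i | (i <= k)%N]) (Z i @^-1` [set h i])); last by apply/seteqP; split.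
have := @bigcap_measurableType _ (g_sigma_algebraType (\bigcup_(i in [set i | (i <= k)%N])
        preimage_set_system setT (Z i) measurable)); apply => i ik.
apply: sub_sigma_algebra; exists i => //; exists [set h i] => //.
by rewrite setTI.
Qed.

Hypothesis Zsub : submartingale P F Z.

Lemma measurable_submartingale k : measurable_fun setT (Z k).
Proof.
case: Zsub => _ /(_ k) Zint _; have := measurable_int _ Zint.
exact: (measurable_EFinP _ _).1.
Qed.

Lemma submartingale_le_integral k A : F k A -> measurable A ->
  (\int[P]_(t in A) (Z k t)%:E <= \int[P]_(t in A) (Z k.+1 t)%:E)%E.
Proof.
move=> FA mA; case: Zsub => _ Zint /(_ k)[g [_ gint /(_ A FA) <-] Zg].
have restr f : P.-integrable setT f -> P.-integrable A f.
  by move=> fint; exact: (integrableS measurableT).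
by apply: ae_le_integral => //; [exact: (restr _ (Zint k))|exact: (restr _ gint)].
Qed.

Lemma measurable_jump eta k : measurable [set t | eta < `|Z k.+1 t - Z k t|].
Proof.
rewrite -[X in measurable X]setTI.
apply: (measurable_fun_ltr (f := cst eta)) => //.
apply: measurableT_comp => //; apply: measurable_funB;
  exact: measurable_submartingale.
Qed.

Lemma nondegenerate_prob eta eta' k A : nondegenerate_steps P F Z eta eta' ->
  F k A -> measurable A ->
  eta' * prob P A <= prob P (A `&` [set t | eta < `|Z k.+1 t - Z k t|]).
Proof.
move=> /(_ k)[g [_ gint gE] eta'g] FA mA.
have P1 := @probability_setT _ _ _ P; have mD := measurable_jump eta k.
rewrite -lee_fin EFinM -!(probE P1)//; last exact: measurableI.
rewrite -integral_cst// setIC -integral_indic// -gE//.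
apply: ae_le_integral => //.
- exact: finite_measure_integrable_cst.
- exact: (integrableS measurableT).
- by apply: filterS eta'g => t /ltW.
Qed.

Lemma integral_fibers (f : T -> R) (ts : seq R) (A : set T) :
  measurable_fun setT f -> measurable A -> uniq ts ->
  (\int[P]_(t in A `&` [set t | f t \in ts]) (f t)%:E =
  (\sum_(s <- ts) prob P (A `&` f @^-1` [set s]) * s)%:E)%E.
Proof.
move=> mf mA; have P1 := @probability_setT _ _ _ P.
have mfs s : measurable (f @^-1` [set s]).
  by rewrite -[X in measurable X]setTI; exact: mf.
elim: ts => [_|s ts IH /andP[sts uts]].
  rewrite big_nil [X in integral _ X _](_ : _ = set0) ?integral_set0//.
  by apply/seteqP; split=> // t [].
rewrite big_cons EFinD -IH// [X in integral _ X _](_ : _ =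
    (A `&` f @^-1` [set s]) `|` (A `&` [set t | f t \in ts])); last first.
  rewrite -setIUr; congr (_ `&` _).
  apply/seteqP; split=> t /=; rewrite inE; first by case/predU1P; [left|right].
  by case=> [->|->]; rewrite ?eqxx ?orbT.
rewrite integral_setU.
- congr (_ + _)%E; rewrite (eq_integral (cst s%:E)).
    by rewrite integral_cst ?(probE P1) ?EFinM 1?muleC//; exact: measurableI.
  by move=> t; rewrite inE => -[_ /= ->].
- exact: measurableI.
- by apply: measurableI => //; exact: preimage_mem_seq.
- by apply/measurable_EFinP; exact: measurable_funS mf.
- apply/disj_set2P/seteqP; split=> // t [[_ /= fs] [_ /=]].
  by rewrite fs (negPf sts).
Qed.

Variables (jumps : seq R) (b eta eta' : R).
Hypothesis jumps_le : forall j, j \in jumps -> `|j| <= b.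
Hypothesis eta_gt0 : 0 < eta.
Hypothesis eta'_gt0 : 0 < eta'.
Hypothesis nondeg : nondegenerate_steps P F Z eta eta'.

Let next (v : R) := undup [seq v + j | j <- jumps].
Hypothesis jumps_as : forall k h,
  P (history Z k h `&` [set t | Z k.+1 t \notin next (h k)]) = 0%E.
Hypothesis Z0 : P (Z 0 @^-1` [set 0]) = 1%E.

Let mZ k s : measurable (Z k @^-1` [set s]).
Proof. by rewrite -[X in measurable X]setTI; exact: measurable_submartingale. Qed.

Let P1 := @probability_setT _ _ _ P.

Let next_mass k h A : measurable A ->
  prob P (history Z k h `&` A) =
  \sum_(s <- next (h k)) prob P (history Z k.+1 (extend k h s) `&` A).
Proof.
move=> mA; have H := @prob_history_next _ _ _ _ P1 _ Z mZ predT next.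
by apply: H => // [s|? ? _]; [exact: undup_uniq|exact: jumps_as].
Qed.

(* The submartingale inequality, integrated over an atom of the filtration. *)
Let next_mean k h : prob P (history Z k h) * h k <=
  \sum_(s <- next (h k)) prob P (history Z k.+1 (extend k h s)) * s.
Proof.
have mh := measurable_history mZ k h; have mZk := measurable_submartingale.
have mnext : measurable [set t | Z k.+1 t \in next (h k)].
  by exact: preimage_mem_seq.
rewrite -lee_fin; under eq_bigr do rewrite history_extend.
rewrite -integral_fibers//; last exact: undup_uniq.
have -> : (\int[P]_(t in history Z k h `&` [set t | Z k.+1 t \in next (h k)])
    (Z k.+1 t)%:E = \int[P]_(t in history Z k h) (Z k.+1 t)%:E)%E.
  rewrite (@negligible_integral _ _ _ _ (history Z k h)
    (history Z k h `&` [set t | Z k.+1 t \notin next (h k)]))//.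
  - congr integral; apply/seteqP; split=> t /= [ht]; first by move=> ->; split=> // -[].
    by move/not_andP => [//|/negP]; rewrite negbK.
  - apply: measurableI => //; rewrite [X in measurable X](_ : _ =
      ~` [set t | Z k.+1 t \in next (h k)]); first exact: measurableC.
    by apply/seteqP; split=> t /= /negP.
  - by case: Zsub => _ /(_ k.+1) Zint _; exact: (integrableS measurableT).
  - exact: jumps_as.
apply: (@le_trans _ _ (\int[P]_(t in history Z k h) (Z k t)%:E)%E); last first.
  exact: submartingale_le_integral (natural_filtration_history h) mh.
rewrite (eq_integral (cst (h k)%:E)).
  by rewrite integral_cst// (probE P1 mh) -EFinM mulrC.
by move=> t; rewrite inE => ht; rewrite /cst ht.
Qed.

Let next_jump k h : eta' * prob P (history Z k h) <=
  \sum_(s <- next (h k)) prob P (history Z k.+1 (extend k h s)) * (eta < `|s - h k|)%R%:R.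
Proof.
have mh := measurable_history mZ k h.
have mD : measurable [set t | eta < `|Z k.+1 t - Z k t|].
  exact: measurable_jump.
apply: le_trans (nondegenerate_prob nondeg (natural_filtration_history h) mh) _.
rewrite next_mass//; apply: ler_sum => s _.
have mh' := measurable_history mZ k.+1 (extend k h s).
have [etas|etas] := boolP (eta < `|s - h k|); rewrite ?mulr1 ?mulr0.
  by apply: (le_prob P1) => //; exact: measurableI.
rewrite [X in prob _ X](_ : _ = set0) ?/prob ?measure0//.
apply/seteqP; split=> // t [ht] /=; rewrite (ht k.+1)// (ht k)//.
by rewrite extend_last /extend leqnn (negPf etas).
Qed.

(* With [m = h k + L >= 0],
   [(s + L) ^ 2 = m ^ 2 + 2 m (s - h k) + (s - h k) ^ 2]: the middle term has
   nonnegative mean by [next_mean], the last one is bounded below by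
   [next_jump]. *)
Let next_drift (L : R) k h : `|h k| <= L ->
  prob P (history Z k h) * ((h k + L) ^+ 2 + eta ^+ 2 * eta') <=
  \sum_(s <- next (h k)) prob P (history Z k.+1 (extend k h s)) * (s + L) ^+ 2.
Proof.
move=> hL; have m0 : 0 <= h k + L by move: hL; rewrite ler_norml; lra.
set q := fun s => prob P (history Z k.+1 (extend k h s)).
apply: (@le_trans _ _ (\sum_(s <- next (h k)) (q s * ((h k + L) ^+ 2 -
   2 * (h k + L) * h k) + 2 * (h k + L) * (q s * s) +
   eta ^+ 2 * (q s * (eta < `|s - h k|)%R%:R)))); last first.
  apply: ler_sum => s _; rewrite -/(q s).
  have -> : q s * ((h k + L) ^+ 2 - 2 * (h k + L) * h k) + 2 * (h k + L) * (q s * s) +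
   eta ^+ 2 * (q s * (eta < `|s - h k|)%R%:R) = q s * ((s + L) ^+ 2 - (s - h k) ^+ 2 +
   eta ^+ 2 * (eta < `|s - h k|)%R%:R) by ring.
  rewrite ler_wpM2l ?prob_ge0// -addrA gerDl addrC subr_le0.
  have [etas|_] := boolP (eta < `|s - h k|); last by rewrite mulr0 sqr_ge0.
  by rewrite mulr1 -[leRHS]real_normK ?num_real// lerXn2r ?nnegrE// ltW.
rewrite !big_split/= -!mulr_suml -!mulr_sumr.
have -> : \sum_(s <- next (h k)) q s = prob P (history Z k h).
  rewrite -[X in prob _ X]setIT next_mass//.
  by apply: eq_bigr => s _; rewrite setIT.
apply: (@le_trans _ _ (prob P (history Z k h) * ((h k + L) ^+ 2 - 2 * (h k + L) * h k) +
  2 * (h k + L) * (prob P (history Z k h) * h k) +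
  eta ^+ 2 * (eta' * prob P (history Z k h)))).
  by rewrite le_eqVlt; apply/orP; left; apply/eqP; ring.
apply: lerD; first apply: lerD => //.
  by apply: ler_wpM2l; [rewrite mulr_ge0|exact: next_mean].
by apply: ler_wpM2l; [exact: sqr_ge0|exact: next_jump].
Qed.

(** The potential is [(v + L) ^ 2], shifted so that it is increasing on the whole
    interval: a submartingale drifts to the right, where it grows. *)
Lemma submartingale_confinement (L : R) k : 0 <= L -> 0 < b ->
  (P [set t | forall i, (i <= k)%N -> (`|Z i t| <= L)%R] <=
  (2 * expR (- (eta ^+ 2 * eta' * k%:R / (2 * (2 * L + b) ^+ 2))))%:E)%E.
Proof.
move=> L0 b0.
pose box : pred R := [pred v | `|v| <= L].
have mbox i : measurable (Z i @^-1` [set` box]).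
  rewrite [X in measurable X](_ : _ = setT `&` Z i @^-1` `[- L, L]).
    exact: measurable_submartingale.
  by rewrite setTI; apply/seteqP; split=> t; rewrite /= in_itv/= -ler_norml.
apply: (@le_trans _ _ (P (stay Z box 0 k))).
  apply: le_measure; rewrite ?inE.
  - rewrite [X in measurable X](_ : _ = stay Z box 0 k).
      exact: measurable_stay.
    by apply/seteqP; split=> t Ht i; [move=> /andP[_]; exact: Ht|exact: Ht].
  - exact: measurable_stay.
  - by move=> t Ht i /andP[_]; exact: Ht.
apply: (@confinement _ _ _ P P1 _ Z mZ box next mbox _ _ (fun v => (v + L) ^+ 2)
  (eta ^+ 2 * eta') ((2 * L + b) ^+ 2) _ _ _ _ _ 0) => //.
- by move=> s; exact: undup_uniq.
- by move=> i h _; exact: jumps_as.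
- by rewrite exprn_gt0// ltr_wpDl// mulr_ge0.
- move=> v; rewrite inE ler_norml => vL; rewrite sqr_ge0/=.
  by rewrite lerXn2r ?nnegrE; lra.
- move=> v s; rewrite inE ler_norml mem_undup => vL /mapP[j /jumps_le].
  rewrite ler_norml => jb ->; rewrite sqr_ge0/=.
  rewrite -[leLHS]real_normK ?num_real// lerXn2r ?nnegrE//; first by lra.
  by rewrite ler_norml; lra.
- move=> i h; exact: next_drift.
- by rewrite mulr_ge0 ?sqr_ge0 ?ltW.
- by rewrite inE/= normr0.
Qed.
End submartingales.

(** * Inner products of sites *)

Section inner_product.
Context (n : nat) (R : realType).
Implicit Types u v w : 'rV[R]_n.+1.

Definition dot u v : R := (u *m v^T) 0 0.

Definition vec (x : site n) : 'rV[R]_n.+1 := map_mx intr x.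

Lemma dotE u v : dot u v = \sum_j u 0 j * v 0 j.
Proof. by rewrite /dot mxE; apply: eq_bigr => j _; rewrite mxE. Qed.

Lemma dotC u v : dot u v = dot v u.
Proof. by rewrite !dotE; apply: eq_bigr => j _; rewrite mulrC. Qed.

Lemma dotDl u v w : dot (u + v) w = dot u w + dot v w.
Proof. by rewrite /dot mulmxDl mxE. Qed.

Lemma dotZl a u w : dot (a *: u) w = a * dot u w.
Proof. by rewrite /dot -scalemxAl mxE. Qed.

Lemma dot0l w : dot 0 w = 0.
Proof. by rewrite /dot mul0mx mxE. Qed.

Lemma dot0r w : dot w 0 = 0.
Proof. by rewrite dotC dot0l. Qed.

Lemma dotDr u v w : dot w (u + v) = dot w u + dot w v.
Proof. by rewrite !(dotC w) dotDl. Qed.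

Lemma dotZr a u w : dot w (a *: u) = a * dot w u.
Proof. by rewrite !(dotC w) dotZl. Qed.

Lemma dot_suml (I : finType) (f : I -> 'rV[R]_n.+1) w :
  dot (\sum_i f i) w = \sum_i dot (f i) w.
Proof. by rewrite /dot mulmx_suml summxE. Qed.

Lemma vec0 : vec 0 = 0. Proof. exact: map_mx0. Qed.

Lemma vecD x y : vec (x + y) = vec x + vec y.
Proof. exact: map_mxD. Qed.

Lemma dot_ge0 u : 0 <= dot u u.
Proof. by rewrite dotE sumr_ge0// => j _; rewrite -expr2 sqr_ge0. Qed.

Lemma dot_gt0 u : u != 0 -> 0 < dot u u.
Proof.
move=> u0; rewrite lt_def dot_ge0 andbT; apply: contra u0 => /eqP.
rewrite dotE => /psumr_eq0P H; apply/eqP/rowP => j; rewrite mxE.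
by apply/eqP; rewrite -sqrf_eq0 expr2 H// => i _; rewrite -expr2 sqr_ge0.
Qed.

Lemma dot_step (e : step n) u : dot (vec (step_vec e)) u = (-1) ^+ e.2 * u 0 e.1.
Proof.
rewrite dotE (bigD1 e.1)//= big1 ?addr0.
  by rewrite !mxE !eqxx mulr1 rmorph_sign.
by move=> j je; rewrite !mxE eqxx (negPf je) mulr0 mulr0z mul0r.
Qed.

Lemma sqr_dot_step (e : step n) u : dot (vec (step_vec e)) u ^+ 2 = u 0 e.1 ^+ 2.
Proof. by rewrite dot_step exprMn sqrr_sign mul1r. Qed.

Lemma dot_step_step (e : step n) : dot (vec (step_vec e)) (vec (step_vec e)) = 1.
Proof.
rewrite dot_step !mxE !eqxx mulr1 rmorph_sign.
by rewrite -expr2 sqrr_sign.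
Qed.

Lemma dot_step_le (e : step n) u : `|dot (vec (step_vec e)) u| <= \sum_j `|u 0 j|.
Proof.
rewrite dot_step normrM normr_sign mul1r (bigD1 e.1)//= lerDl.
exact: sumr_ge0.
Qed.
End inner_product.

(** * The transverse walk *)

Lemma range_condition_transverse_submartingale (R : realType) (n : nat)
    (nu : probability (environment n R) R)
    (Q : R.-pker (environment n R) ~> (trajectory n)) (l : 'rV[R]_n.+1) (eta eta' : R) :
  let P := annealed_law nu Q in
  let X' := transverse l in
  let F' := natural_filtration X' in
  quenched_law Q -> submartingale P F' X' -> 0 < eta -> 0 < eta' ->
  nondegenerate_steps P F' X' eta eta' -> range_condition P.
Proof.
move=> P X' F' Q_markov X'sub eta0 eta'0 nondeg.
have P1 := @probability_setT _ _ _ P.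
pose jump (e : step n) := dot (vec R (step_vec e)) l.
pose jumps := [seq jump e | e <- enum {: step n}].
pose b := \sum_j `|l 0 j| + 1.
have b0 : 0 < b by rewrite ltr_wpDl// sumr_ge0.
have jump_b e : `|jump e| <= b by rewrite (le_trans (dot_step_le _ _))// lerDl.
have X'S k e X : X k.+1 = X k + step_vec e -> X' k.+1 X = X' k X + jump e.
  by move=> Xk; rewrite /X' /transverse Xk /jump -dotDl -vecD.
have mX' k (B : set R) : measurable (X' k @^-1` B).
  exact: (measurable_position k [set x | B (dot (vec R x) l)]).
have Pwalks k : P (~` @walks n k) = 0%E.
  by apply: (measureC_full P1); [exact: measurable_walks|exact: annealed_walks].
apply: (@range_condition_of_confinement _ _ _ (eta ^+ 2 * eta' / (8 * b ^+ 2))).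
  by rewrite divr_gt0 ?mulr_gt0 ?exprn_gt0.
move=> r k r0.
have br : 0 <= b * r by rewrite mulr_ge0// ltW.
apply: (@le_trans _ _ (P [set X | forall i, (i <= k)%N -> (`|X' i X| <= b * r)%R])).
  have mB : measurable [set X | forall i, (i <= k)%N -> (`|X' i X| <= b * r)%R].
    rewrite [X in measurable X](_ : _ = \bigcap_(i in [set i | (i <= k)%N])
      (X' i @^-1` [set v | `|v| <= b * r])); last by apply/seteqP; split.
    by apply: bigcap_measurableType => i _; exact: (mX' i [set v | _]).
  have mW := @measurable_walks n k.
  apply: (le_measure_full P1 mW) => //.
  - exact: measurable_range_le.
  - exact: annealed_walks.
  move=> X /= [[X0 wX] Xr].
  move=> i ik; pose N (x : site n) := `|dot (vec R x) l| / b.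
  have := @range_size_ge _ _ N k X _ _ X0 wX i ik; rewrite /N.
  rewrite vec0 {1}/dot mul0mx mxE normr0 mul0r => /(_ (lexx _)) H.
  have {}H := H _.
  suff /H : forall x e, `|dot (vec R (x + step_vec e)) l| / b <= `|dot (vec R x) l| / b + 1.
    move=> {}H; rewrite mulrC -ler_pdivrMr//; apply: le_trans Xr.
    by apply: le_trans H; rewrite lerDl.
  move=> x e; rewrite ler_pdivrMr// mulrDl mul1r divfK ?gt_eqF//.
  by rewrite vecD dotDl (le_trans (ler_normD _ _))// lerD2l; exact: jump_b.
apply: (le_trans (@submartingale_confinement _ _ _ P X' X'sub jumps b eta eta' _ eta0 eta'0
  nondeg _ _ (b * r) k br b0)).
- by move=> _ /mapP[e _ ->]; exact: jump_b.
- move=> j h; apply/eqP; rewrite -measure_le0 -(Pwalks j.+1).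
  apply: le_measure; rewrite ?inE.
  + apply: measurableI; first by apply: measurable_history => i x; exact: (mX' i [set x]).
    exact: (mX' j.+1 [set v | v \notin _]).
  + by apply: measurableC; exact: measurable_walks.
  + move=> X [hX /= Xj] [_ wX]; move/negP: Xj; apply; rewrite mem_undup -(hX j)//.
    have /neighboursP[e Xe] : X j.+1 \in neighbours (X j).
      by apply: wX; rewrite leq0n add0n ltnSn.
    by apply/mapP; exists (jump e); [rewrite map_f ?mem_enum|exact: X'S].
- have m0 := mX' 0%N [set 0]; apply/eqP; rewrite eq_le (probability_le1 P m0)/=.
  rewrite -(annealed_walks Q_markov nu 0); apply: le_measure; rewrite ?inE.
  + exact: measurable_walks.
  + exact: m0.
  + move=> X [/= X0 _]; rewrite /X' /transverse X0.
    by rewrite -[map_mx _ _]/(vec R 0) vec0 mul0mx mxE.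
rewrite lee_fin ler_pM2l// ler_expR lerN2.
have d1 : 0 < 8 * b ^+ 2 * (r + 1) ^+ 2.
  by rewrite !mulr_gt0 ?exprn_gt0// ltr_wpDl.
have d2 : 0 < 2 * (2 * (b * r) + b) ^+ 2.
  by rewrite mulr_gt0 ?exprn_gt0// ltr_wpDl// mulr_ge0.
have -> : eta ^+ 2 * eta' / (8 * b ^+ 2) * k%:R / (r + 1) ^+ 2 =
  eta ^+ 2 * eta' * k%:R / (8 * b ^+ 2 * (r + 1) ^+ 2).
  by field; rewrite !gt_eqF// ltr_wpDl.
rewrite ler_wpM2l//; first by rewrite !mulr_ge0// ?sqr_ge0 ?ltW.
rewrite lef_pV2// (_ : _ * (r + 1) ^+ 2 = 2 * (2 * b * (r + 1)) ^+ 2); last by ring.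
rewrite ler_pM2l// lerXn2r ?nnegrE; nra.
Qed.

(** * Quadratic functions with a common drift *)

Section drift.
Context (n : nat) (R : realType).
Implicit Types (u v w l : 'rV[R]_n.+1) (p q : step n -> R).

Definition norm1 v : R := \sum_j `|v 0 j|.

Lemma norm1_ge0 v : 0 <= norm1 v.
Proof. exact: sumr_ge0. Qed.

Lemma norm1Z a v : norm1 (a *: v) = `|a| * norm1 v.
Proof. by rewrite /norm1 mulr_sumr; apply: eq_bigr => j _; rewrite mxE normrM. Qed.

Lemma dot_le r v w : (forall j, `|v 0 j| <= r) -> `|dot v w| <= r * norm1 w.
Proof.
move=> vr; rewrite dotE (le_trans (ler_norm_sum _ _ _))// mulr_sumr.
by apply: ler_sum => j _; rewrite normrM ler_wpM2r.
Qed.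

Lemma dot_self_le r v : (forall j, `|v 0 j| <= r) -> dot v v <= n.+1%:R * r ^+ 2.
Proof.
move=> vr; have r0 : 0 <= r by apply: le_trans (vr 0).
rewrite dotE (@le_trans _ _ (\sum_(j < n.+1) r ^+ 2))//; last first.
  by rewrite sumr_const card_ord mulr_natl.
apply: ler_sum => j _; rewrite -expr2 -[leLHS]real_normK ?num_real//.
by rewrite lerXn2r ?nnegrE.
Qed.

Definition mean p : 'rV[R]_n.+1 := \sum_e p e *: vec R (step_vec e).

Lemma dot_mean p w : dot (mean p) w = \sum_e p e * dot (vec R (step_vec e)) w.
Proof. by rewrite /mean dot_suml; apply: eq_bigr => e _; rewrite dotZl. Qed.

Definition quadratic (s t : R) u l v := s * dot v v - t * dot v u ^+ 2 + dot v l.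

Definition drift_of p (f : 'rV[R]_n.+1 -> R) v :=
  \sum_e p e * f (v + vec R (step_vec e)) - f v.

Lemma drift_quadratic p s t u l v : \sum_e p e = 1 ->
  drift_of p (quadratic s t u l) v =
  s * (2 * dot v (mean p) + 1)
  - t * (2 * dot v u * dot (mean p) u + \sum_e p e * u 0 e.1 ^+ 2)
  + dot (mean p) l.
Proof.
move=> p1; rewrite /drift_of.
transitivity (\sum_e (p e * quadratic s t u l v +
    (s * (2 * (p e * dot (vec R (step_vec e)) v) + p e)
    - t * (2 * dot v u * (p e * dot (vec R (step_vec e)) u) + p e * u 0 e.1 ^+ 2)
    + p e * dot (vec R (step_vec e)) l)) - quadratic s t u l v).
  congr (_ - _); apply: eq_bigr => e _; rewrite /quadratic -sqr_dot_step.
  rewrite !(dotDl, dotDr) dot_step_step (dotC v (vec R _)); ring.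
rewrite big_split/= -mulr_suml p1 mul1r addrAC subrr add0r.
rewrite big_split/= sumrB -!mulr_sumr !big_split/= -!mulr_sumr p1.
by rewrite -!dot_mean (dotC v (mean p)).
Qed.

Lemma quadratic_le s t u l v r : (forall j, `|v 0 j| <= r) ->
  `|quadratic s t u l v| <=
    (`|s| * n.+1%:R + `|t| * norm1 u ^+ 2) * r ^+ 2 + r * norm1 l.
Proof.
move=> vr; have r0 : 0 <= r by apply: le_trans (vr 0).
rewrite (le_trans (ler_normD _ _))// lerD//; last exact: dot_le.
rewrite (le_trans (ler_normB _ _))// mulrDl lerD//.
  by rewrite normrM (ger0_norm (dot_ge0 v)) -mulrA ler_wpM2l// dot_self_le.
rewrite normrM normrX -mulrA ler_wpM2l// -exprMn lerXn2r ?nnegrE//.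
  by rewrite mulr_ge0// norm1_ge0.
by rewrite mulrC; apply: dot_le.
Qed.

(** The bounds [c] and [K] do not depend on [r], but the function may: the drift is
    only required in the box of size [r] and the quadratic bound only on its
    neighbourhood. *)
Definition common_drift p q : Prop :=
  exists c K : R, [/\ 0 < c, 0 < K & forall r, 0 <= r ->
    exists f : 'rV[R]_n.+1 -> R,
      (forall v, (forall j, `|v 0 j| <= r) ->
        c <= drift_of p f v /\ c <= drift_of q f v) /\
      (forall v, (forall j, `|v 0 j| <= r + 1) -> `|f v| <= K * (r + 1) ^+ 2)].

Lemma common_driftC p q : common_drift p q -> common_drift q p.
Proof.
move=> [c [K [c0 K0 H]]]; exists c, K; split=> // r /H[f [f1 f2]].
by exists f; split=> // v /f1[].
Qed.

Lemma quadratic_common_drift p q s t u l cp cq : 0 < cp -> 0 < cq ->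
  (forall v, cp <= drift_of p (quadratic s t u l) v) ->
  (forall v, cq <= drift_of q (quadratic s t u l) v) ->
  common_drift p q.
Proof.
move=> cp0 cq0 Hp Hq.
exists (Num.min cp cq), (`|s| * n.+1%:R + `|t| * norm1 u ^+ 2 + norm1 l + 1); split.
- by rewrite lt_min cp0.
- by rewrite ltr_wpDl// !addr_ge0 ?mulr_ge0 ?sqr_ge0 ?norm1_ge0.
move=> r r0; exists (quadratic s t u l); split=> v vr.
  by rewrite !ge_min Hp Hq orbT.
apply: le_trans (quadratic_le _ _ _ _ vr) _.
rewrite -addrA [leRHS]mulrDl lerD2l [leRHS]mulrC.
apply: (@ler_pM _ (r + 1) _ (norm1 l)); rewrite ?norm1_ge0 ?addr_ge0//.
  by rewrite expr2 ler_peMl ?addr_ge0// lerDr.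
by rewrite lerDl.
Qed.

(** [|v| ^ 2] gains exactly 1 per step under the centered law [p]. Under [q] its
    gain [2 v . m + 1] may be negative in the box, but [v . m] is at least
    [- r |m|_1] there, and the multiple of [v . m] that compensates is of order
    [r], so that the whole function is of order [(r + 1) ^ 2]. *)
Lemma common_drift_centered p q : \sum_e p e = 1 -> \sum_e q e = 1 ->
  mean p = 0 -> common_drift p q.
Proof.
move=> p1 q1 p0; pose m := mean q.
exists 1, (n.+1%:R + 2 * norm1 m ^+ 2 / dot m m); split => //.
  by rewrite ltr_pwDl// divr_ge0 ?dot_ge0// mulr_ge0 ?sqr_ge0.
move=> r r0; pose M := 2 * (r + 1) * norm1 m / dot m m.
have M0 : 0 <= M by rewrite divr_ge0 ?dot_ge0 ?mulr_ge0 ?norm1_ge0 ?addr_ge0.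
exists (quadratic 1 0 0 (M *: m)); split=> v vr.
  rewrite !drift_quadratic// p0 !mul0r !subr0 !mul1r; split.
    by rewrite dot0l dot0r mulr0 add0r addr0.
  rewrite dotZr -/m; suff : 0 <= 2 * dot v m + M * dot m m by lra.
  have [->|m0] := eqVneq m 0.
    by rewrite dot0l dot0r !mulr0 addr0.
  rewrite /M divfK ?gt_eqF ?dot_gt0//.
  have := dot_le m vr; rewrite ler_norml => /andP[+ _].
  have := norm1_ge0 m; nra.
apply: le_trans (quadratic_le _ _ _ _ vr) _.
rewrite normr0 mul0r addr0 normr1 mul1r norm1Z ger0_norm// [leRHS]mulrDl lerD2l /M.
by rewrite le_eqVlt; apply/orP; left; apply/eqP; ring.
Qed.

(** The form [s |v| ^ 2 - (v . u) ^ 2] has a drift independent of [v], because its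
    gradient is orthogonal to [u], to which both means are parallel. The drift
    is the transverse variance [var]. If [var] vanished for both laws, all steps
    of both would be parallel to [u]; as these steps span all the axes, that is
    impossible in dimension at least 2. *)
Lemma common_drift_opposite p q (a : R) : (0 < n)%N ->
  (forall e, 0 <= p e) -> (forall e, 0 <= q e) ->
  \sum_e p e = 1 -> \sum_e q e = 1 ->
  (forall j, exists2 e : step n, e.1 = j & 0 < p e \/ 0 < q e) ->
  mean q != 0 -> a < 0 -> mean p = a *: mean q -> common_drift p q.
Proof.
move=> n0 p_ge0 q_ge0 p1 q1 span; set u := mean q => u0 a0 pa.
pose s := dot u u; have s0 : 0 < s by exact: dot_gt0.
have us j : u 0 j ^+ 2 <= s.
  by rewrite /s dotE (bigD1 j)//= -expr2 lerDl sumr_ge0// => i _; rewrite -expr2 sqr_ge0.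
pose var (g : step n -> R) := s - \sum_e g e * u 0 e.1 ^+ 2.
have varE g : \sum_e g e = 1 -> var g = \sum_e g e * (s - u 0 e.1 ^+ 2).
  move=> g1; under [RHS]eq_bigr do rewrite mulrBr.
  by rewrite sumrB -mulr_suml g1 mul1r.
have var_ge0 g : (forall e, 0 <= g e) -> \sum_e g e = 1 -> 0 <= var g.
  by move=> g0 g1; rewrite varE// sumr_ge0// => e _; rewrite mulr_ge0// subr_ge0.
have driftE g k l b v : \sum_e g e = 1 -> mean g = b *: u ->
    drift_of g (quadratic (k * s) k u l) v = k * var g + b * dot u l.
  by move=> g1 gb; rewrite drift_quadratic// gb dotZr !dotZl /var -/s; ring.
have qb : mean q = 1 *: u by rewrite scale1r.
have [varp|varp] := ltP 0 (var p).
  (* [u] points along the mean of [q]; [k] is large enough to make up for the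
     loss [- a * s] of the linear part under [p]. *)
  pose k := (1 - a * s) / var p.
  have k0 : 0 <= k by rewrite divr_ge0 ?(ltW varp)// subr_ge0; nra.
  apply: (@quadratic_common_drift _ _ (k * s) k u u 1 s) => // v.
    by rewrite (driftE _ _ _ a)// /k divfK ?gt_eqF// -/s subrK.
  rewrite (driftE _ _ _ 1)// mul1r lerDr mulr_ge0//; exact: var_ge0.
have [varq|varq] := ltP 0 (var q).
  (* The same with the two laws exchanged: [- u] points along the mean of [p]. *)
  pose k := (1 + s) / var q.
  have k0 : 0 <= k by rewrite divr_ge0 ?(ltW varq)// addr_ge0// ltW.
  apply: (@quadratic_common_drift _ _ (k * s) k u (-1 *: u) (- a * s) 1) => //.
  - by rewrite mulr_gt0// oppr_gt0.
  - move=> v; rewrite (driftE _ _ _ a)// dotZr mulN1r mulrN -mulNr lerDr mulr_ge0//.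
    exact: var_ge0.
  - move=> v; rewrite (driftE _ _ _ 1)// /k divfK ?gt_eqF// dotZr -/s mul1r mulN1r.
    by rewrite addrK.
have eq0 (g : step n -> R) e : (forall e, 0 <= g e) -> \sum_e g e = 1 -> var g <= 0 ->
    0 < g e -> u 0 e.1 ^+ 2 = s.
  move=> g0 g1 varg ge; have : var g == 0 by rewrite eq_le varg var_ge0.
  rewrite varE// psumr_eq0; last by move=> i _; rewrite mulr_ge0// subr_ge0.
  move=> /allP/(_ e); rewrite mem_index_enum => /(_ isT)/=.
  by rewrite mulf_eq0 gt_eqF//= subr_eq0 => /eqP.
(* Every squared coordinate of [u] would equal their sum [s]. *)
have all_s j : u 0 j ^+ 2 = s.
  by have [e <- [pe|qe]] := span j; [exact: (eq0 p)|exact: (eq0 q)].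
have : s = n.+1%:R * s.
  by rewrite {1}/s dotE; under eq_bigr do rewrite -expr2 all_s;
     rewrite sumr_const card_ord mulr_natl.
rewrite -natr1 mulrDl mul1r => /eqP.
by rewrite eq_sym addrC -subr_eq0 addrAC subrr add0r mulf_eq0 pnatr_eq0 !gt_eqF.
Qed.

Lemma common_drift_linear p q l : \sum_e p e = 1 -> \sum_e q e = 1 ->
  0 < dot (mean p) l -> 0 < dot (mean q) l -> common_drift p q.
Proof.
move=> p1 q1 pl ql; apply: (@quadratic_common_drift _ _ 0 0 0 l) pl ql _ _ => v.
  by rewrite drift_quadratic// !mul0r subr0 add0r.
by rewrite drift_quadratic// !mul0r subr0 add0r.
Qed.

(** By the equality case of the Cauchy-Schwarz inequality, two nonzero means are
    parallel or some combination of them has positive product with both. *)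
Lemma exists_common_drift p q : (0 < n)%N ->
  (forall e, 0 <= p e) -> (forall e, 0 <= q e) ->
  \sum_e p e = 1 -> \sum_e q e = 1 ->
  (forall j, exists2 e : step n, e.1 = j & 0 < p e \/ 0 < q e) ->
  common_drift p q.
Proof.
move=> n0 p_ge0 q_ge0 p1 q1 span.
have [mp0|mp0] := eqVneq (mean p) 0; first exact: common_drift_centered.
have [mq0|mq0] := eqVneq (mean q) 0.
  by apply: common_driftC; exact: common_drift_centered.
set P := dot (mean p) (mean p); set Q := dot (mean q) (mean q).
set r := dot (mean p) (mean q).
have P0 : 0 < P by exact: dot_gt0.
have Q0 : 0 < Q by exact: dot_gt0.
(* [w] is [Q] times the component of [mean p] orthogonal to [mean q]. *)
pose w := Q *: mean p + (- r) *: mean q.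
have ww : dot w w = Q * (P * Q - r ^+ 2).
  rewrite /w !(dotDl, dotDr, dotZl, dotZr) (dotC (mean q) (mean p)) -/P -/Q -/r.
  ring.
have [w0|w0] := eqVneq w 0.
  have pq : mean p = (r / Q) *: mean q.
    apply: (scalerI (lt0r_neq0 Q0)); rewrite scalerA mulrC divfK ?gt_eqF//.
    by apply/eqP; rewrite -subr_eq0 -scaleNr -/w w0.
  have [r0|r0|r0] := ltgtP r 0.
  - by apply: (@common_drift_opposite p q (r / Q)) => //; rewrite ltr_pdivrMr// mul0r.
  - by apply: (@common_drift_linear p q (mean q)).
  - by move: mp0; rewrite pq r0 mul0r scale0r eqxx.
have D : 0 < P * Q - r ^+ 2 by rewrite -(pmulr_rgt0 _ Q0) -ww dot_gt0.
apply: (@common_drift_linear p q ((Q - r) *: mean p + (P - r) *: mean q)) => //;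
  rewrite !(dotDr, dotZr) ?(dotC (mean q) (mean p)) -/P -/Q -/r.
  by rewrite (_ : _ + _ = P * Q - r ^+ 2)//; ring.
by rewrite (_ : _ + _ = P * Q - r ^+ 2)//; ring.
Qed.
End drift.

(** * Two-valued environments *)

Lemma eq_probability d (T : measurableType d) (R : realType) (P P' : probability T R) :
  (P = P' :> (set T -> \bar R)) -> P = P'.
Proof.
move: P P' => [m c] [m' c'] /= mm'; move: m' mm' c' => _ <- c'; congr Probability.Pack.
move: c c' => [[p0 p1] [p2] [p3] [p4] [p5] [p6] [p7]]
  [[q0 q1] [q2] [q3] [q4] [q5] [q6] [q7]].
rewrite (Prop_irrelevance q0 p0) (Prop_irrelevance q1 p1) in q2 *.
by rewrite (Prop_irrelevance q2 p2) (Prop_irrelevance q3 p3)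
  (Prop_irrelevance q4 p4) (Prop_irrelevance q5 p5) (Prop_irrelevance q6 p6)
  (Prop_irrelevance q7 p7).
Qed.

Section site_laws.
Context (n : nat) (R : realType).
Implicit Types g : site_law n R.

Lemma measurable_eval (U : set (step n)) :
  measurable_fun setT (fun g : site_law n R => g U).
Proof.
exact: (measurable_kernel (kprobability (@measurable_id _ (site_law n R) setT))).
Qed.

Lemma eq_site_law g g' : (forall e, g [set e] = g' [set e]) -> g = g'.
Proof.
move=> gg'; apply: eq_probability; apply/funext => A.
have P1 (h : site_law n R) : h setT = 1%E by exact: probability_setT.
have AE (h : site_law n R) : h A = (\sum_(e <- enum {: step n}) prob h (A `&` [set e]))%:E.
  rewrite -(prob_fibers (P1 h) (Z := id))//; last exact: enum_uniq.
  rewrite -(probE (P1 h))//; congr (h _).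
  by apply/seteqP; split=> [e Ae|e []//]; split=> //=; rewrite mem_enum.
rewrite !AE; congr (_%:E); apply: eq_bigr => e _; rewrite /prob.
have [Ae|nAe] := pselect (A e).
  have -> : A `&` [set e] = [set e] by apply/seteqP; split=> x /=; [case|move=> ->].
  exact: (congr1 fine (gg' e)).
rewrite (_ : A `&` _ = set0) ?measure0//.
by apply/seteqP; split=> // x /= [Ax xe]; apply: nAe; rewrite -xe.
Qed.

(** A law on a finite set is determined by its finitely many weights, each of which
    is a measurable function of the law. *)
Lemma measurable_site_law1 g0 : measurable [set g0].
Proof.
rewrite [X in measurable X](_ : _ = \bigcap_(e in [set: step n])
  (setT `&` (fun g : site_law n R => g [set e]) @^-1` [set g0 [set e]])).
  apply: fin_bigcap_measurable; first exact: finite_finset.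
  by move=> e _; apply: measurable_eval => //; exact: emeasurable_set1.
apply/seteqP; split=> [g -> e _|g H]; first by [].
by apply: eq_site_law => e; have [] := H e Logic.I.
Qed.

(** An orthogonal set contains at most one of [e_i] and [- e_i], so one with [d]
    elements meets every axis. *)
Lemma condition2_axes (mu : probability (site_law n R) R) g1 g2 :
    condition2 mu -> mu [set g1; g2] = 1%E ->
  forall j, exists2 e : step n, e.1 = j & 0 < weight g1 e \/ 0 < weight g2 e.
Proof.
move=> [V [V_orth V_card V_mu]] mu1 j.
have fst_inj : {in V &, injective (fun e : step n => e.1)}.
  move=> [i b] [i' b'] uV vV /= ii'; rewrite -{i'}ii' in vV *.
  have [//|neq] := eqVneq (i, b) (i, b').
  have := V_orth _ _ uV vV neq; rewrite mxE (bigD1 i)//= big1 ?addr0.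
    by rewrite !mxE !eqxx !mulr1 => /eqP; rewrite mulf_eq0 !signr_eq0.
  by move=> k ki; rewrite !mxE eqxx (negPf ki) mulr0 mul0r.
have /imsetP[e eV je] : j \in [set e.1 | e in V]%SET.
  suff -> : [set e.1 | e in V]%SET = [set: 'I_n.+1]%SET by rewrite finset.in_setT.
  by apply/eqP; rewrite eqEcard finset.subsetT cardsT card_ord card_in_imset// V_card leqnn.
exists e => //; apply: contrapT => /not_orP[/negP + /negP].
rewrite -!leNgt => w1 w2.
have g0 (g : site_law n R) : weight g e <= 0 -> g [set e] = 0%E.
  move=> wg; rewrite -[LHS]fineK ?fin_num_measure// -/(weight g e).
  by congr EFin; apply/eqP; rewrite eq_le wg weight_ge0.
have mS : measurable [set g : site_law n R | step_support g e].
  rewrite [X in measurable X](_ : _ = setT `&`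
      (fun g : site_law n R => g [set e]) @^-1` (~` [set 0%E])).
    apply: measurable_eval => //; apply: measurableC; exact: emeasurable_set1.
  rewrite setTI; apply/seteqP; split=> g /=; rewrite /step_support/= lt0e.
    by move=> /andP[/eqP].
  by move/eqP => ->; rewrite measure_ge0.
have mG : measurable [set g1; g2] by apply: measurableU; exact: measurable_site_law1.
have := V_mu _ eV; apply/negP; rewrite -leNgt.
have mGC : mu (~` [set g1; g2]) = 0%E by rewrite probability_setC// mu1 subee.
rewrite -mGC; apply: le_measure; rewrite ?inE//; first exact: measurableC.
by move=> g /= + gg; rewrite /step_support/=; case: gg => ->; rewrite g0// ltxx.
Qed.

Lemma iid_two_valued (mu : probability (site_law n R) R)
    (nu : probability (environment n R) R) g1 g2 :
  iid_environment mu nu -> mu [set g1; g2] = 1%E ->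
  {ae nu, forall w, forall x, [set g1; g2] (w x)}.
Proof.
move=> iid mu1.
have mG : measurable [set g1; g2] by apply: measurableU; exact: measurable_site_law1.
have mx x : measurable [set w : environment n R | [set g1; g2] (w x)].
  apply: sub_sigma_algebra; exists x => //; exists [set g1; g2] => //.
  by rewrite setTI.
have nux x : nu (~` [set w : environment n R | [set g1; g2] (w x)]) = 0%E.
  rewrite probability_setC// [X in (1 - X)%E](_ : _ = 1%E) ?subee//.
  rewrite -mu1; have := iid [:: x] (fun=> [set g1; g2]) isT (fun=> mG).
  rewrite big_seq1 => <-; congr (nu _).
  apply/seteqP; split=> w H => [y|]; first by rewrite mem_seq1 => /eqP ->.
  by apply: H; rewrite mem_seq1.
suff H : nu.-negligible (\bigcup_(k : nat)
    (if unpickle k is Some x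
     then ~` [set w : environment n R | [set g1; g2] (w (x : 'rV[int]_n.+1))]
     else set0)).
  apply: negligibleS H => w /= /existsNP[x wx].
  by exists (pickle (x : 'rV[int]_n.+1)) => //=; rewrite pickleK.
apply: negligible_bigcup => k; case: unpickle => [x|]; last exact: negligible_set0.
exists (~` [set w : environment n R | [set g1; g2] (w x)]).
by split; [apply: measurableC; exact: mx|exact: nux|exact: subset_refl].
Qed.
End site_laws.

Section quenched_confinement.
Context (n : nat) (R : realType) (Q : R.-pker (environment n R) ~> (trajectory n)).
Hypothesis Q_markov : quenched_law Q.

(** [f] is shifted by its bound [K (r + 1) ^ 2], so as to be nonnegative. *)
Lemma quenched_range_le (g1 g2 : site_law n R) (c K : R) (w : environment n R)
    (r : R) k (f : 'rV[R]_n.+1 -> R) :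
  (forall x, [set g1; g2] (w x)) -> 0 <= r -> 0 < c -> 0 < K ->
  (forall v : 'rV[R]_n.+1, (forall j, `|v 0 j| <= r) ->
     c <= drift_of (weight g1) f v /\ c <= drift_of (weight g2) f v) ->
  (forall v : 'rV[R]_n.+1, (forall j, `|v 0 j| <= r + 1) -> `|f v| <= K * (r + 1) ^+ 2) ->
  (Q w [set X | ((range_size k X)%:R <= r)%R] <=
     (2 * expR (- (c / (4 * K) * k%:R / (r + 1) ^+ 2)))%:E)%E.
Proof.
move=> w12 r0 c0 K0 fdrift fK.
have Q1 := @prob_kernel _ _ _ _ _ Q w.
pose position (i : nat) (X : trajectory n) : site n := X i.
have m_position i x : measurable (position i @^-1` [set x]).
  exact: (measurable_position i [set x]).
pose box : pred (site n) := [pred x | [forall j, `|vec R x 0 j| <= r]].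
have mbox i : measurable (position i @^-1` [set` box]).
  exact: (measurable_position i [set` box]).
have step1 (x : site n) e j : `|vec R (x + step_vec e) 0 j| <= `|vec R x 0 j| + 1.
  rewrite vecD mxE (le_trans (ler_normD _ _))// lerD2l !mxE eqxx/=.
  rewrite intrM rmorph_sign normrM normr_sign mul1r.
  by case: eqP; rewrite ?normr1 ?normr0.
apply: (@le_trans _ _ (Q w (stay position box 0 k))).
  have mS : measurable (stay position box 0 k) by exact: measurable_stay.
  apply: (le_measure_full Q1 (@measurable_walks n k.+1)) => //.
  - exact: measurable_range_le.
  - exact: quenched_walks.
  move=> X /= [[X0 wX] Xr].
  move=> i /=; rewrite add0n => ik; apply/forallP => j.
  pose N (x : site n) := `|vec R x 0 j|.
  have wXk : walk_from 0 k X.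
    by move=> m /andP[_ mk]; apply: wX; rewrite leq0n/= ltnW.
  have := @range_size_ge _ _ N k X _ _ X0 wXk i ik; rewrite /N.
  rewrite vec0 mxE normr0 => /(_ (lexx _)) H.
  have {}H := H (fun x e => step1 x e j).
  by apply: le_trans Xr; apply: le_trans H; rewrite lerDl.
pose Phi := 2 * K * (r + 1) ^+ 2.
have r1 : 0 < r + 1 by rewrite ltr_wpDl.
have Phi0 : 0 < Phi by rewrite !mulr_gt0// exprn_gt0.
pose phi x := f (vec R x) + K * (r + 1) ^+ 2.
have phiP x : (forall j, `|vec R x 0 j| <= r + 1) -> 0 <= phi x <= Phi.
  by move=> /fK; rewrite ler_norml /phi /Phi; lra.
have -> : c / (4 * K) * k%:R / (r + 1) ^+ 2 = c * k%:R / (2 * Phi).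
  by rewrite /Phi; field; rewrite !gt_eqF.
apply: (@confinement _ _ _ (Q w) Q1 _ position m_position box (@neighbours n) mbox
  _ _ phi c Phi _ _ _ _ _ 0) => //.
- exact: neighbours_uniq.
- move=> i h _; apply/eqP; rewrite -measure_le0.
  have mW := @measurable_walks n i.+1.
  have <- : Q w (~` walks i.+1) = 0%E.
    by apply: (measureC_full Q1) => //; exact: quenched_walks.
  apply: le_measure; rewrite ?inE.
  + apply: measurableI; first exact: measurable_history.
    exact: (measurable_position i.+1 [set x | x \notin _]).
  + exact: measurableC.
  + move=> X [hX /= /negP Xi] [_ wX]; apply: Xi; rewrite -(hX i)//.
    by apply: wX; rewrite leq0n add0n ltnSn.
- move=> x /forallP xr; apply: phiP => j; rewrite (le_trans (xr j))// lerDl//.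
- move=> x y /forallP xr /neighboursP[e ->]; apply: phiP => j.
  by rewrite (le_trans (step1 x e j))// lerD2r.
- move=> i h /forallP hr; rewrite (quenched_next Q_markov) ler_wpM2l ?prob_ge0//.
  have : c <= drift_of (weight (w (h i))) f (vec R (h i)).
    by have [] := fdrift _ hr; case: (w12 (h i)) => ->.
  rewrite /phi /drift_of.
  under [X in _ -> _ <= X]eq_bigr do rewrite mulrDr vecD.
  by rewrite big_split/= -mulr_suml sum_weight mul1r; lra.
- exact: ltW.
- by apply/forallP => j; rewrite vec0 mxE normr0.
- apply/eqP; rewrite eq_le; apply/andP; split.
    by rewrite -Q1; apply: le_measure; rewrite ?inE//; exact: measurableT.
  rewrite -(quenched_walks Q_markov w 0); apply: le_measure; rewrite ?inE//.
  + exact: measurable_walks.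
  + by move=> X [].
Qed.
End quenched_confinement.

Lemma range_condition_two_valued (R : realType) (n : nat) (mu : probability (site_law n R) R)
    (nu : probability (environment n R) R)
    (Q : R.-pker (environment n R) ~> (trajectory n)) :
  (0 < n)%N -> iid_environment mu nu -> quenched_law Q -> condition2 mu ->
  two_valued mu -> range_condition (annealed_law nu Q).
Proof.
move=> n0 iid Q_markov cond2 [g1 [g2 [_ _ _ mu12]]].
have axes := condition2_axes cond2 mu12.
have [c [K [c0 K0 drift]]] := exists_common_drift n0 (@weight_ge0 _ _ g1)
  (@weight_ge0 _ _ g2) (sum_weight g1) (sum_weight g2) axes.
apply: (@range_condition_of_confinement _ _ _ (c / (4 * K))).
  by rewrite divr_gt0// mulr_gt0.
move=> r k r0; have [f [fdrift fK]] := drift r r0.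
set B := (2 * _)%:E.
have -> : B = (\int[nu]_w (cst B w))%E.
  rewrite integral_cst// [X in (_ * X)%E](_ : _ = 1%E) ?mule1//.
  exact: probability_setT.
apply: ae_ge0_le_integral => //.
- by apply: measurable_kernel; exact: measurable_range_le.
- by move=> w _; rewrite /cst lee_fin mulr_ge0 ?expR_ge0.
- apply: negligibleS (iid_two_valued iid mu12) => w; apply: contra_not => w12 _.
  exact: (quenched_range_le Q_markov k w12 r0 c0 K0 fdrift fK).
Qed.

(** * Polynomial growth of the range *)

Theorem proposition3 (R : realType) (n : nat) (d_ge2 : (2 <= n.+1)%N)
    (mu : probability (site_law n R) R)
    (nu : probability (environment n R) R)
    (Q : R.-pker (environment n R) ~> (trajectory n))
    (nu_iid : iid_environment mu nu) (Q_markov : quenched_law Q)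
    (mu_cond1 : condition1 mu) (mu_cond2 : condition2 mu) :
  let P := annealed_law nu Q in
  ((exists2 l : 'rV[R]_n.+1, l != 0 &
      let X' := transverse l in
      let F' := natural_filtration X' in
      [/\ submartingale P F' X', bounded_steps P X' &
          exists eta eta' : R, [/\ 0 < eta, 0 < eta' &
            nondegenerate_steps P F' X' eta eta']]) ->
    range_condition P) /\
  (two_valued mu -> range_condition P).
Proof.
split=> [[l _ [X'sub _ [eta [eta' [eta0 eta'0 nondeg]]]]]|two].
  exact: range_condition_transverse_submartingale X'sub eta0 eta'0 nondeg.
exact: range_condition_two_valued nu_iid Q_markov mu_cond2 two.
Qed.
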